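(* Let $n\geq 1$, $A\in \mathrm{GL}(n,\mathbb C)$ and $a=(a_k)_{k=1}^n\in\mathbb C^n$. Then $$1+(A^{-1}a,a)=\frac{\det\big(A+a\otimes a\big)}{\det A}.$$
   Context: Here $a\otimes a=(a_ka_r)_{k,r=1}^n\in\mathrm{Mat}(n,\mathbb C)$, and the pairing is the bilinear one, $(x,y)=\sum_{k=1}^n x_ky_k$ (no complex conjugation). *)

(* Defs.v *)
From mathcomp Require Import all_boot all_order all_algebra.
From mathcomp Require Import reals complex.

Set Implicit Arguments.
Unset Strict Implicit.
Unset Printing Implicit Defensive.

Import GRing.Theory.
Local Open Scope ring_scope.

(* Vectors of C^n are column vectors, so that a matrix M acts by M *m x. *)

(* No conjugation, even over the complex numbers: this is not the Hermitian
   inner product. *)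
Definition pairing (K : pzRingType) (n : nat) (x y : 'cV[K]_n) : K :=
  \sum_(k < n) x k 0 * y k 0.

Definition tensor (K : pzRingType) (n : nat) (a b : 'cV[K]_n) : 'M[K]_n :=
  \matrix_(k < n, r < n) (a k 0 * b r 0).

(* Main.v *)
Require Import Defs.
From mathcomp Require Import all_boot all_order all_algebra.
From mathcomp Require Import reals complex.

Import GRing.Theory.

Local Open Scope ring_scope.
Local Open Scope complex_scope.

(* Multiplying [[1, -U], [V, 1]] on the left, resp. on the right, by the
   unipotent [[1, U], [0, 1]] clears its upper right block, leaving the Schur
   complement 1 + UV, resp. 1 + VU, on the diagonal. *)
Lemma det_1Dmulmx_comm (K : comPzRingType) (m n : nat)
    (U : 'M[K]_(m, n)) (V : 'M[K]_(n, m)) :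
  \det (1%:M + U *m V) = \det (1%:M + V *m U).
Proof.
pose M := block_mx 1%:M (- U) V 1%:M.
pose E := block_mx 1%:M U 0 1%:M.
have detE : \det E = 1 by rewrite det_ublock !det1 mulr1.
have detEM : \det (E *m M) = \det (1%:M + U *m V).
  by rewrite mulmx_block !mul1mx !mulmx1 !mul0mx !add0r addNr det_lblock
             det1 mulr1.
have detME : \det (M *m E) = \det (1%:M + V *m U).
  by rewrite mulmx_block !mul1mx !mulmx1 !mulmx0 !addr0 subrr det_lblock
             det1 mul1r addrC.
by rewrite -detEM -detME !det_mulmx mulrC.
Qed.

Lemma tensorE (K : pzRingType) (n : nat) (a b : 'cV[K]_n) :
  tensor a b = a *m b^T.
Proof. by apply/matrixP=> k r; rewrite !mxE big_ord1 !mxE. Qed.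

(** The transpose falls on [y] to match the order in which the factors come out of
    [det_1Dmulmx_comm]; this reverses each product, hence the commutative [K]. *)
Lemma pairingE (K : comPzRingType) (n : nat) (x y : 'cV[K]_n) :
  pairing x y = (y^T *m x) 0 0.
Proof. by rewrite mxE; apply: eq_bigr => k _; rewrite mxE mulrC. Qed.

(** The matrix determinant lemma: pulling [A] out on the left leaves a perturbation of the identity
    by a column times a row. *)
Lemma det_add_tensor (K : comUnitRingType) (n : nat) (A : 'M[K]_n)
    (a b : 'cV[K]_n) :
  A \in unitmx ->
  \det (A + tensor a b) = \det A * (1 + pairing (invmx A *m a) b).
Proof.
move=> uA; have -> : A + tensor a b = A *m (1%:M + (invmx A *m a) *m b^T).
  by rewrite mulmxDr mulmx1 !mulmxA mulmxV // mul1mx tensorE.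
(* Swapping the column [invmx A *m a] with the row [b^T] turns the n by n determinant into a 1 by 1
   one, whose only entry is the scalar sought. *)
by rewrite det_mulmx det_1Dmulmx_comm det_mx11 pairingE [in LHS]mxE
           [1%:M _ _]mxE eqxx.
Qed.

Theorem lemma5p2 (R : realType) (n : nat) (hn : (1 <= n)%N)
    (A : 'M[R[i]]_n) (hA : A \in unitmx) (a : 'cV[R[i]]_n) :
  1 + pairing (invmx A *m a) a = \det (A + tensor a a) / \det A.
Proof.
(* Take [b := a]; the division cancels because [A] is invertible exactly when [\det A] is a unit. *)
by rewrite det_add_tensor // mulrC mulKr // -unitmxE.
Qed.
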